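(* Let $C = C(\beta;\lambda_1,\dots,\lambda_g)$ be a $\mathfrak{c}$-admissible cone and let $\xi$ be a non-trivial element of $X(\mathfrak{c})$. For integers $0 \le k \le K$ define the rational function $$B_{k,K}(x) := (-1)^k \sum_{n=k}^{K} \binom{n}{k}\left(\frac{x}{x-1}\right)^{n} \in \mathbb{Q}(x).$$ For an integer $N \geq 0$ define the polynomial $F_N(C,\xi;T) \in \mathbb{Q}(\xi)[T]$ by $$F_N(C,\xi;T) := A(C,\xi) \sum_{k_1,\dots,k_g=0}^{(N-1)d} (1+T)^{\mathcal{N}(\beta+\underline{k}\cdot\underline{\lambda})} \prod_{i=1}^g B_{k_i,(N-1)d}(\xi(\lambda_i)),$$ where $\underline{k}\cdot\underline{\lambda} := k_1\lambda_1+\cdots+k_g\lambda_g \in \mathbb{Z}_E$ and $$A(C,\xi) := \frac{\xi(\beta)}{\prod_{i=1}^g (1-\xi(\lambda_i))}.$$ Then $$F(C,\xi;T) \equiv F_N(C,\xi;T) \pmod{T^N}.$$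
   Context: Setting: $p$ is a prime, $q:=4$ if $p=2$ and $q:=p$ otherwise. $E$ is a totally real number field of degree $d$ with ring of integers $\mathbb{Z}_E$; for $\alpha\in E$ its conjugates are $\alpha^{(1)},\dots,\alpha^{(d)}\in\mathbb{R}$. $\mathbb{Z}_E^+$ is the set of totally positive elements of $\mathbb{Z}_E$, and $\mathcal{N}$ is the absolute norm (for totally positive $\alpha$, $\mathcal{N}(\alpha)=\prod_i\alpha^{(i)}$). $\bar{\mathbb{Q}}$ is the algebraic closure of $\mathbb{Q}$ in $\mathbb{C}$, with a fixed embedding into $\mathbb{C}_p$. $\mathfrak{m}=\mathfrak{f}\mathfrak{z}$ is a modulus of $E$ whose finite part $\mathfrak{f}$ (an integral ideal) is divisible by $q$ and whose infinite part $\mathfrak{z}$ contains all real places; $\mathfrak{c}$ is a prime ideal of $E$ of residual degree $1$, coprime to $\mathfrak{f}$; $c=\mathcal{N}(\mathfrak{c})$ is the prime number below $\mathfrak{c}$. $\mathfrak{a}$ is an integral ideal coprime to $\mathfrak{c}$ and $\mathfrak{f}$. $X(\mathfrak{c})$ is the group of additive characters modulo $\mathfrak{c}$: group homomorphisms $\xi:\mathbb{Z}_E\to\mathbb{C}^\times$ whose kernel contains $\mathfrak{c}$. $\mathbb{Q}(\xi)$ is the field generated by the values of $\xi$. A (discrete) cone with base point $\beta$ and generators $\lambda_1,\dots,\lambda_g$ ($1\le g\le d$), where $\beta,\lambda_1,\dots,\lambda_g\in\mathfrak{a}\cap\mathbb{Z}_E^+$ and the $\lambda_i$ are linearly independent,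 is the set $C(\beta;\lambda_1,\dots,\lambda_g):=\{\beta+\sum_{i=1}^g n_i\lambda_i : n_i\in\mathbb{N}\}$ ($\mathbb{N}=\{0,1,2,\dots\}$). It is $\mathfrak{c}$-admissible if no $\lambda_i$ belongs to $\mathfrak{c}$. For $r\in\mathbb{C}$, $(1+T)^r:=\sum_{n\ge0}\binom{r}{n}T^n$; for $\alpha\in E$, $(1+\underline{T})^\alpha:=\prod_{i=1}^d(1+T_i)^{\alpha^{(i)}}\in\bar{\mathbb{Q}}[[T_1,\dots,T_d]]$. Put $$G(C,\xi;\underline{T}):=\frac{\xi(\beta)(1+\underline{T})^\beta}{\prod_{i=1}^g(1-\xi(\lambda_i)(1+\underline{T})^{\lambda_i})}\in\bar{\mathbb{Q}}[[T_1,\dots,T_d]].$$ $\Omega:\mathbb{C}[[T_1,\dots,T_d]]\to\mathbb{C}[[T]]$ is the continuous linear map which extends the linear map on polynomials defined for $(a_1,\dots,a_d)\in\mathbb{N}^d$ by $$\Omega(T_1^{a_1}\cdots T_d^{a_d}):=(-1)^{a_1+\cdots+a_d}\sum_{n_1=0}^{a_1}\cdots\sum_{n_d=0}^{a_d}\Bigl(\prod_{i=1}^d(-1)^{n_i}\binom{a_i}{n_i}\Bigr)(1+T)^{n_1\cdots n_d}$$ (the image of $T_1^{a_1}\cdots T_d^{a_d}$ is divisible by $T^{\max(a_1,\dots,a_d)}$, so the extension exists). Finally $F(C,\xi;T):=\Omega(G(C,\xi;\underline{T}))$. *)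

(* Defs.v *)
From HB Require Import structures.
From mathcomp Require Import all_boot all_order all_algebra all_field.
From mathcomp Require Import boolp classical_sets reals complex.
From mathcomp Require Import mpoly.

Set Implicit Arguments.
Unset Strict Implicit.
Unset Printing Implicit Defensive.

Import Order.TTheory GRing.Theory Num.Theory.

Local Open Scope ring_scope.
Local Open Scope classical_set_scope.

(* ** The ring K[[T_1, ..., T_d]] *)

(* A formal power series is the family of its coefficients, indexed by the
   monomials 'X_{1..d}.  The record prevents confusion with the pointwise
   operations on functions. *)
Record mps (d : nat) (K : Type) := MPS { mps_coef :> 'X_{1..d} -> K }.

Section PowerSeriesRing.
Variables (d : nat) (K : comNzRingType).
Implicit Types (f g h : mps d K) (m : 'X_{1..d}).

Lemma mpsP f g : (forall m, f m = g m) -> f = g.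
Proof. by case: f g => [f] [g] /= fg; congr MPS; apply: funext. Qed.

HB.instance Definition _ := gen_eqMixin (mps d K).
HB.instance Definition _ := gen_choiceMixin (mps d K).

Definition mps_zero : mps d K := MPS (fun=> 0).
Definition mps_opp f := MPS (fun m => - f m).
Definition mps_add f g := MPS (fun m => f m + g m).
Definition mpsC (c : K) : mps d K := MPS (fun m => if m == 0%MM then c else 0).

(* Every k <= m has degree at most mdeg m, so this is the full Cauchy product. *)
Definition mps_mul f g := MPS (fun m =>
  \sum_(k : 'X_{1..d < (mdeg m).+1} | (k <= m)%MM) f k * g (m - k)%MM).

Lemma mps_addA : associative mps_add.
Proof. by move=> f g h; apply: mpsP => m /=; rewrite addrA. Qed.
Lemma mps_addC : commutative mps_add.
Proof. by move=> f g; apply: mpsP => m /=; rewrite addrC. Qed.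
Lemma mps_add0 : left_id mps_zero mps_add.
Proof. by move=> f; apply: mpsP => m /=; rewrite add0r. Qed.
Lemma mps_addN : left_inverse mps_zero mps_opp mps_add.
Proof. by move=> f; apply: mpsP => m /=; rewrite addNr. Qed.

HB.instance Definition _ :=
  GRing.isZmodule.Build (mps d K) mps_addA mps_addC mps_add0 mps_addN.

Definition mps_trunc k f : {mpoly K[d]} :=
  \sum_(m : 'X_{1..d < k}) f m *: 'X_[m].

Lemma mps_truncE k f m : (mdeg m < k)%N -> (mps_trunc k f)@_m = f m.
Proof. exact: mcoeff_mpoly. Qed.

Lemma mps_mulE k f g m : (mdeg m < k)%N ->
  mps_mul f g m = (mps_trunc k f * mps_trunc k g)@_m.
Proof.
move=> mk; rewrite /= -[_ * _]/(mpoly_mul _ _).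
rewrite (mcoeff_poly_mul_lin _ _ (ltnSn (mdeg m))).
apply: eq_bigr => l lem; rewrite !mps_truncE //.
  by apply: leq_ltn_trans (mdegB _ _) mk.
by apply: leq_trans (bmdeg l) mk.
Qed.

Lemma eq_mcoeffM k (p p' q q' : {mpoly K[d]}) m : (mdeg m < k)%N ->
    (forall l, (mdeg l < k)%N -> p@_l = p'@_l) ->
    (forall l, (mdeg l < k)%N -> q@_l = q'@_l) ->
  (p * q)@_m = (p' * q')@_m.
Proof.
move=> mk pp' qq'; rewrite -[_ * q]/(mpoly_mul _ _) -[_ * q']/(mpoly_mul _ _).
rewrite !(mcoeff_poly_mul_lin _ _ (ltnSn (mdeg m))); apply: eq_bigr => l _.
rewrite pp' ?qq' //; last by apply: leq_trans (bmdeg l) mk.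
by apply: leq_ltn_trans (mdegB _ _) mk.
Qed.

Lemma mps_mulC : commutative mps_mul.
Proof.
by move=> f g; apply: mpsP => m; rewrite !(mps_mulE _ _ (ltnSn _)) mulrC.
Qed.

Lemma mps_mulA : associative mps_mul.
Proof.
move=> f g h; apply: mpsP => m; rewrite !(mps_mulE _ _ (ltnSn _)).
set k := (mdeg m).+1; have mk : (mdeg m < k)%N by [].
have trM u v l : (mdeg l < k)%N ->
    (mps_trunc k (mps_mul u v))@_l = (mps_trunc k u * mps_trunc k v)@_l.
  by move=> lk; rewrite mps_truncE // (mps_mulE _ _ lk).
rewrite (eq_mcoeffM (p' := mps_trunc k f)
  (q' := mps_trunc k g * mps_trunc k h) mk) //; last exact: trM.
by rewrite mulrA; apply/esym/(eq_mcoeffM mk) => // l /trM.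
Qed.

Lemma mps_mul1 : left_id (mpsC 1) mps_mul.
Proof.
move=> f; apply: mpsP => m; rewrite (mps_mulE _ _ (ltnSn _)).
rewrite (eq_mcoeffM (p' := 1) (q' := mps_trunc (mdeg m).+1 f) (ltnSn _)) //.
  by rewrite mul1r mps_truncE.
by move=> l lk; rewrite mps_truncE //= mcoeff1; case: (_ == _).
Qed.

Lemma mps_mulDl : left_distributive mps_mul mps_add.
Proof.
move=> f g h; apply: mpsP => m /=; rewrite -big_split /=.
by apply: eq_bigr => k _; rewrite mulrDl.
Qed.

Lemma mps_one_neq0 : mpsC 1 != 0.
Proof.
apply/eqP => /(congr1 (fun f : mps d K => f 0%MM)) /= /eqP.
by rewrite eqxx oner_eq0.
Qed.

HB.instance Definition _ := GRing.Zmodule_isComNzRing.Build (mps d K)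
  mps_mulA mps_mulC mps_mul1 mps_mulDl mps_one_neq0.

Lemma mpsD f g m : (f + g) m = f m + g m. Proof. by []. Qed.
Lemma mpsN f m : (- f) m = - f m. Proof. by []. Qed.
Lemma mpsM f g m : (f * g) m =
  \sum_(k : 'X_{1..d < (mdeg m).+1} | (k <= m)%MM) f k * g (m - k)%MM.
Proof. by []. Qed.
Lemma mps1E m : (1 : mps d K) m = (m == 0%MM)%:R.
Proof. by rewrite -[LHS]/(if _ then _ else _); case: (_ == _). Qed.

Lemma mpsCM c f m : (mpsC c * f) m = c * f m.
Proof.
rewrite -[LHS]/(mps_mul _ _ _) (mps_mulE _ _ (ltnSn _)).
rewrite (eq_mcoeffM (p' := c%:MP) (q' := mps_trunc (mdeg m).+1 f) (ltnSn _)) //.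
  by rewrite mcoeffCM mps_truncE.
move=> l lk; rewrite mps_truncE //= mcoeffC.
by case: (_ == _); rewrite ?mulr1 ?mulr0.
Qed.

Lemma mpsCMC c c' : mpsC c * mpsC c' = mpsC (c * c').
Proof.
by apply: mpsP => m; rewrite mpsCM /=; case: (_ == _); rewrite ?mulr0.
Qed.

Lemma mpsM0 f g : (f * g) 0%MM = f 0%MM * g 0%MM.
Proof.
have k0 : (mdeg (0%MM : 'X_{1..d}) < 1)%N by rewrite mdeg0.
rewrite -[LHS]/(mps_mul _ _ _) (mps_mulE _ _ k0) mcoeff0_is_multiplicative.
by rewrite !mps_truncE.
Qed.

End PowerSeriesRing.

Section PowerSeriesInverse.
Variables (d : nat) (K : fieldType).
Implicit Types (f g : mps d K).

Definition mps_unit : {pred mps d K} := fun f => f 0%MM != 0.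

(* f^-1 = f(0)^-1 * \sum_k (1 - f / f(0))^k; the k-th term only has monomials
   of degree at least k. *)
Definition mps_inv f := if f \in mps_unit then
  MPS (fun m => (f 0%MM)^-1 *
    \sum_(k < (mdeg m).+1) ((1 - mpsC d (f 0%MM)^-1 * f) ^+ k) m) else f.

Lemma mps_expr_low f k m : f 0%MM = 0 -> (mdeg m < k)%N -> (f ^+ k) m = 0.
Proof.
move=> f0; elim: k m => // k IHk m mk; rewrite exprS mpsM big1 // => l lem.
have [l0 | l_gt0] := posnP (mdeg (l : 'X_{1..d})).
  by move/eqP: l0; rewrite mdeg_eq0 => /eqP ->; rewrite f0 mul0r.
rewrite [X in _ * X]IHk ?mulr0 //.
have dm : mdeg m = (mdeg (m - l) + mdeg l)%N by rewrite -mdegD submK.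
have lt_dm a b c : (c = a + b -> 0 < b -> a < c)%N.
  by move=> -> b0; rewrite -[X in (X < _)%N]addn0 ltn_add2l.
by apply: leq_trans (lt_dm _ _ _ dm l_gt0) _; rewrite -ltnS.
Qed.

Lemma mps_mulVr : {in mps_unit, left_inverse 1 mps_inv *%R}.
Proof.
move=> f fu; have f0 : f 0%MM != 0 by [].
set c := f 0%MM in f0; set u := 1 - mpsC d c^-1 * f.
have u0 : u 0%MM = 0.
  by rewrite mpsD mps1E eqxx mpsN mpsCM mulVf // subrr.
have fE : f = mpsC d c * (1 - u).
  by rewrite /u opprB addrC subrK mulrA mpsCMC divff // mul1r.
apply: mpsP => m; set k := (mdeg m).+1.
pose g := mpsC d c^-1 * \sum_(i < k) u ^+ i.
have sumE (F : nat -> mps d K) j l : (\sum_(i < j) F i) l = \sum_(i < j) F i l.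
  by elim: j => [|j IHj]; rewrite ?big_ord0 // !big_ord_recr mpsD IHj.
have gE l : (mdeg l < k)%N -> mps_inv f l = g l.
  move=> lk; rewrite /g mpsCM sumE /mps_inv fu [LHS]/= -/c -/u; congr (_ * _).
  rewrite (big_ord_widen_cond k xpredT (fun i => (u ^+ i) l)) //.
  rewrite big_mkcond /=; apply: eq_bigr => i _; case: ltnP => // li.
  by rewrite mps_expr_low.
transitivity ((g * f) m).
  by rewrite !mpsM; apply: eq_bigr => l _; rewrite gE // (bmdeg l).
have -> : g * f = 1 - u ^+ k.
  rewrite /g fE mulrCA mulrA mulrA mpsCMC divff // mul1r mulrC.
  by rewrite -[RHS]opprB (subrX1 u k) -mulNr (opprB u 1).
by rewrite mpsD mpsN mps_expr_low // subr0.
Qed.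

Lemma mps_unitP f g : g * f = 1 -> mps_unit f.
Proof.
move=> /(congr1 (fun f : mps d K => f 0%MM)); rewrite mpsM0 mps1E eqxx => gf1.
by apply/eqP => f0; move: gf1 => /eqP; rewrite f0 mulr0 eq_sym oner_eq0.
Qed.

Lemma mps_inv_out : {in [predC mps_unit], mps_inv =1 id}.
Proof. by move=> f /negbTE fu; rewrite /mps_inv fu. Qed.

HB.instance Definition _ := GRing.ComNzRing_hasMulInverse.Build (mps d K)
  mps_mulVr mps_unitP mps_inv_out.

End PowerSeriesInverse.

(* ** Totally real number fields *)

Section NumberField.
Variable E : fieldExtType rat.
Implicit Types (x y : E) (I J P : set E).

Definition ZE : set E := [set x | integralOver (intr : int -> E) x].

Definition integral_ideal I :=
  [/\ I `<=` ZE, exists2 x, I x & x != 0,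
      forall x y, I x -> I y -> I (x + y) &
      forall x y, ZE x -> I y -> I (x * y)].

Definition prime_ideal P :=
  [/\ integral_ideal P, ~ P 1 &
      forall x y, ZE x -> ZE y -> P (x * y) -> P x \/ P y].

Definition coprime_ideals I J := exists2 x, I x & J (1 - x).

Definition ideal_divisible_by I (n : nat) :=
  forall x, I x -> exists2 y, ZE y & x = n%:R * y.

(* N(I) = #(ZE / I) = n, by a full system r of representatives. *)
Definition ideal_norm_is I (n : nat) :=
  exists r : 'I_n -> E, (forall i, ZE (r i)) /\
    forall x, ZE x -> exists! i, I (x - r i).

(* The prime number c lies below P, and P has residual degree e. *)
Definition residual_degree_is P (c e : nat) :=
  [/\ prime c, P c%:R & ideal_norm_is P (c ^ e)].

Definition totally_real (R : realType) :=
  forall (sigma : {rmorphism E -> R[i]}) x, sigma x \is Num.real.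

(* s enumerates the real embeddings without repetition, so that s i x is the
   i-th conjugate of x. *)
Definition real_embeddings (R : realType) d (s : 'I_d -> {rmorphism E -> R}) :=
  (forall i j, s i =1 s j -> i = j) /\
  (forall sigma : {rmorphism E -> R}, exists i, s i =1 sigma).

Definition ZEplus (R : realType) d (s : 'I_d -> {rmorphism E -> R}) : set E :=
  [set x | ZE x /\ forall i, 0 < s i x].

(* N_{E/Q}(x) is the determinant of the multiplication by x. *)
Definition field_norm x : rat :=
  \det (\matrix_(i, j < \dim {:E})
          coord (vbasis {:E}) j (x * (vbasis {:E})`_i)).

(* |N_{E/Q}(x)|, meaningful for x in ZE, where N_{E/Q}(x) is an integer; see
   abs_normE. *)
Definition abs_norm x : nat := `|numq (field_norm x)|%N.

Lemma rmorph_scale_rat (L : fieldType) (f : {rmorphism E -> L}) a x :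
  f (a *: x) = ratr a * f x.
Proof.
rewrite -mulr_algl rmorphM; congr (_ * _).
exact: (fmorph_eq_rat (f \o in_alg E)).
Qed.

Lemma embeddings_free (L : fieldType) d (s : 'I_d -> {rmorphism E -> L})
    (r : seq 'I_d) (w : 'I_d -> L) : (forall i j, s i =1 s j -> i = j) ->
    uniq r -> (forall x, \sum_(i <- r) w i * s i x = 0) ->
  {in r, forall i, w i = 0}.
Proof.
move=> s_inj; elim: r w => // j r IHr w /= /andP[jr r_uniq] w0.
have wr0 : {in r, forall i, w i = 0}.
  move=> i ir; apply: contrapT => /eqP wi.
  suff /s_inj ij : s i =1 s j by rewrite -ij ir in jr.
  move=> y; apply/eqP; rewrite -subr_eq0; apply/eqP.
  have /(_ i ir) /eqP : {in r, forall i, w i * (s i y - s j y) = 0}.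
    apply: IHr => // x; have := w0 (y * x); have := w0 x.
    rewrite !big_cons => wx wyx.
    transitivity ((w j * s j (y * x) + \sum_(k <- r) w k * s k (y * x)) -
                  s j y * (w j * s j x + \sum_(k <- r) w k * s k x)).
      rewrite rmorphM mulrDr opprD addrACA [X in _ = X + _](_ : _ = 0) ?add0r.
        rewrite mulr_sumr -sumrB; apply: eq_bigr => k _.
        by rewrite rmorphM mulrBr mulrBl !mulrA [s j y * w k]mulrC.
      by rewrite mulrCA subrr.
    by rewrite wx wyx mulr0 subr0.
  by rewrite mulf_eq0 (negbTE wi) => /eqP.
move=> i; rewrite inE => /predU1P[->|]; last exact: wr0.
have := w0 1; rewrite big_cons big_seq big1 => [|k /wr0 ->]; last by rewrite mul0r.
by rewrite addr0 rmorph1 mulr1.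
Qed.

Lemma field_normE (R : realType) d (s : 'I_d -> {rmorphism E -> R}) x :
    d = \dim {:E} -> (forall i j, s i =1 s j -> i = j) ->
  ratr (field_norm x) = \prod_i s i x.
Proof.
move=> dE s_inj; subst d; pose e := vbasis {:E}.
pose V : 'M[R]_(\dim {:E}) := \matrix_(j, i) s i e`_j.
have V_neq0 : \det V != 0.
  rewrite -det_tr; apply/det0P => -[v v0 vV].
  have w0 y : \sum_i v 0 i * s i y = 0.
    rewrite [y](coord_vbasis (memvf y)).
    under eq_bigr => i _ do rewrite rmorph_sum mulr_sumr.
    rewrite exchange_big big1 // => j _.
    under eq_bigr => i _ do rewrite rmorph_scale_rat mulrCA.
    have /(congr1 (fun M : 'rV_ _ => M 0 j)) := vV; rewrite !mxE => vj0.
    rewrite -mulr_sumr; suff -> : \sum_i v 0 i * s i e`_j = 0 by rewrite mulr0.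
    by rewrite -[RHS]vj0; apply: eq_bigr => i _; rewrite !mxE.
  case/eqP: v0; apply/rowP => i; rewrite mxE.
  by apply: (embeddings_free s_inj (index_enum_uniq _) w0); rewrite mem_index_enum.
apply: (mulfI V_neq0); rewrite /field_norm -det_map_mx mulrC -det_mulmx.
have -> : map_mx ratr (\matrix_(i, j) coord e j (x * e`_i)) *m V =
          V *m diag_mx (\row_i s i x).
  apply/matrixP => i k; rewrite mul_mx_diag !mxE.
  rewrite [RHS]mulrC -rmorphM /= [x * _](coord_vbasis (memvf _)) rmorph_sum.
  by apply: eq_bigr => j _; rewrite !mxE rmorph_scale_rat.
by rewrite det_mulmx det_diag; congr (_ * _); apply: eq_bigr => i _; rewrite mxE.
Qed.

Lemma abs_normE (R : realType) d (s : 'I_d -> {rmorphism E -> R}) x :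
    d = \dim {:E} -> (forall i j, s i =1 s j -> i = j) -> ZEplus s x ->
  (abs_norm x)%:R = \prod_i s i x.
Proof.
move=> dE s_inj [xZ x_gt0]; have nE := field_normE x dE s_inj.
have : integralOver (intr : int -> R) (\prod_i s i x).
  elim/big_ind: _ => [|u v|i _].
  - exact: (integral1 (intr : {rmorphism int -> R})).
  - exact: (@integral_mul _ _ (intr : {rmorphism int -> R})).
  have [p p_mon px] := xZ; exists p => //.
  rewrite -(fmorph_root (s i)) in px; congr (is_true (root _ _)): px.
  by rewrite -map_poly_comp; apply: eq_map_poly => z /=; rewrite rmorph_int.
rewrite -nE => -[p p_mon p_root].
have n_int : field_norm x \is a Num.int.
  have : (ratr (field_norm x) : algC) \in Aint.
    apply: (@root_monic_Aint (map_poly intr p)).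
    + have -> : map_poly (intr : int -> algC) p =
          map_poly ratr (map_poly (intr : int -> rat) p).
        by rewrite -map_poly_comp; apply: eq_map_poly => z /=; rewrite ratr_int.
      rewrite fmorph_root -(fmorph_root (@ratr R)) -map_poly_comp.
      by congr (is_true (root _ _)): p_root; apply: eq_map_poly => z /=;
         rewrite ratr_int.
    + exact: monic_map.
    + by apply/polyOverP => i; rewrite coef_map /= rpred_int.
  move=> /(Cint_rat_Aint (Crat_rat _)) /intrP[z /eqP].
  by rewrite -(ratr_int _ z) fmorph_eq => /eqP ->;
     rewrite rpred_int.
have n_gt0 : 0 < field_norm x.
  by rewrite -(ltr0q R) nE; apply: prodr_gt0 => i _.
have [z nz] := intrP n_int; move: n_gt0; rewrite /abs_norm nz.
by rewrite ltr0z numq_int ratr_int => z0; rewrite natr_absz gtr0_norm.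
Qed.

End NumberField.

(* ** The map Omega *)

Section Omega.
Variables (d : nat) (K : comNzRingType).
Implicit Types (f g : mps d K) (a : 'X_{1..d}).

Definition Omega_monomial a : {poly K} :=
  (-1) ^+ mdeg a *:
  \sum_(n : 'X_{1..d < (mdeg a).+1} | (n <= a)%MM)
     (\prod_(i < d) ((-1) ^+ (n : 'X_{1..d}) i * 'C(a i, (n : 'X_{1..d}) i)%:R))
     *: (1 + 'X) ^+ (\prod_(i < d) (n : 'X_{1..d}) i)%N.

(* The univariate series Omega f is given by its coefficients.  The image of
   T^a is divisible by T^(a i) for every i (Omega_monomial_coef0), so only the
   monomials with all exponents at most n contribute to the coefficient of
   T^n; this is the continuous linear extension of Omega_monomial. *)
Definition Omega f : nat -> K := fun n =>
  \sum_(a : {ffun 'I_d -> 'I_n.+1})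
     f [multinom (a i : nat) | i < d] *
     (Omega_monomial [multinom (a i : nat) | i < d])`_n.

Lemma Omega_monomial_coef0 a i n : (n < a i)%N -> (Omega_monomial a)`_n = 0.
Proof.
move=> n_ai.
pose F (m : 'X_{1..d}) : {poly K} :=
  (\prod_(i < d) ((-1) ^+ m i * 'C(a i, m i)%:R)) *:
    (1 + 'X) ^+ (\prod_(i < d) m i)%N.
pose upd (l : 'X_{1..d}) j : 'X_{1..d} :=
  [multinom if k == i then j else l k | k < d].
have updE l j k : upd l j k = if k == i then j else l k by rewrite mnmE.
have updK (l : 'X_{1..d}) : upd l (l i) = l.
  by apply/mnmP => k; rewrite updE; case: eqP => [->|].
have upd_upd l j j' : upd (upd l j) j' = upd l j'.
  by apply/mnmP => k; rewrite !updE; case: eqP.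
have bnd (l : 'X_{1..d}) : (l <= a)%MM -> (mdeg l < (mdeg a).+1)%N.
  move/mnm_lepP => la; rewrite ltnS !mdegE.
  by apply: leq_sum => k _; apply: la.
pose B := 'X_{1..d < (mdeg a).+1}.
pose b (l : 'X_{1..d}) : B := insubd (BMultinom (bm0_proof d (mdeg a))) l.
have bE l : (l <= a)%MM -> b l = l :> 'X_{1..d}.
  by move=> /bnd la; rewrite /b insubdK.
have upd_le l j : (l <= a)%MM -> (j <= a i)%N -> (upd l j <= a)%MM.
  move=> /mnm_lepP la ja; apply/mnm_lepP => k; rewrite updE.
  by case: eqP => [->|_].
have SE : \sum_(m : B | (m <= a)%MM) F m =
    \sum_(l : B | (l <= a)%MM && ((l : 'X_{1..d}) i == 0%N))
      \sum_(j < (a i).+1) F (upd l j).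
  rewrite pair_big_dep /=.
  rewrite (reindex_onto (fun lj : B * 'I_(a i).+1 => b (upd lj.1 lj.2))
    (fun m => (b (upd m 0%N), inord ((m : 'X_{1..d}) i)))) /=; last first.
    move=> m ma; apply: val_inj => /=; have /mnm_lepP/(_ i) mi := ma.
    by rewrite !bE ?upd_le ?inordK ?ltnS // ?upd_upd ?updK.
  rewrite (eq_bigl (fun lj : B * 'I_(a i).+1 =>
      (lj.1 <= a)%MM && ((lj.1 : 'X_{1..d}) i == 0%N) && true)); last first.
    move=> [l j] /=; have ja : (j <= a i)%N by rewrite -ltnS.
    rewrite andbT; apply/andP/andP => [[m_a /eqP[lE _]] | [la /eqP l0]].
      move: (b _) m_a lE => m m_a <-.
      by rewrite bE ?upd_le // ?updE ?eqxx.
    have lj_a : (upd l j <= a)%MM by rewrite upd_le.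
    rewrite bE //; split=> //; apply/eqP; congr (_, _); apply: val_inj => /=.
      by rewrite upd_upd bE ?upd_le // -l0 updK.
    by rewrite updE eqxx inordK.
  apply: eq_bigr => -[l j] /= /andP[/andP[la _] _].
  by rewrite bE // upd_le // -ltnS.
rewrite /Omega_monomial coefZ -[\sum_(m | _) _]/(\sum_(m : B | (m <= a)%MM) F m) SE.
rewrite coef_sum big1 ?mulr0 // => l _.
pose P := (\prod_(k < d | k != i) (l : 'X_{1..d}) k)%N.
pose c : K := \prod_(k < d | k != i)
  ((-1) ^+ (l : 'X_{1..d}) k * 'C(a k, (l : 'X_{1..d}) k)%:R).
have FE j : F (upd l j) =
    c *: ((1 ^+ (a i - j) * (- (1 + 'X) ^+ P) ^+ j) *+ 'C(a i, j)).
  rewrite /F (bigD1 i) //= [in (\prod_(k < d) _)%N](bigD1 i) //= updE eqxx.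
  rewrite (eq_bigr (fun k => (-1) ^+ (l : 'X_{1..d}) k *
    'C(a k, (l : 'X_{1..d}) k)%:R)) => [|k ki]; last by rewrite updE (negbTE ki).
  rewrite (eq_bigr (l : 'X_{1..d})) => [|k ki]; last by rewrite updE (negbTE ki).
  rewrite -/P -/c expr1n mul1r (exprNn ((1 + 'X) ^+ P)) mulnC exprM mulrC -scalerA; congr (_ *: _).
  by rewrite -mul_polyC polyCM polyC_exp polyCN polyC_natr mulrAC mulr_natr.
under eq_bigr => j _ do rewrite FE.
rewrite -scaler_sumr -exprDn coefZ.
have [q ->] : exists q : {poly K}, 1 - (1 + 'X) ^+ P = 'X * q.
  exists (- \sum_(j < P) (1 + 'X) ^+ j).
  by rewrite -[LHS]opprB subrX1 addrAC subrr add0r mulrN.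
by rewrite exprMn coefXnM n_ai mulr0.
Qed.

(* The series T^a. *)
Definition mpsX a : mps d K := MPS (fun m => (m == a)%:R).

Lemma OmegaX a n : Omega (mpsX a) n = (Omega_monomial a)`_n.
Proof.
rewrite /Omega.
have [an|/existsNP[i /negP]] := pselect (forall i, (a i < n.+1)%N); last first.
  rewrite -leqNgt => n_ai.
  rewrite (Omega_monomial_coef0 n_ai) big1 // => b _ /=.
  case: eqP => [ba|]; last by rewrite mul0r.
  by move: n_ai; rewrite -ba mnmE ltnNge -ltnS ltn_ord.
have aE : [multinom (([ffun i => inord (a i)] : {ffun 'I_d -> 'I_n.+1}) i : nat)
            | i < d] = a.
  by apply/mnmP => i; rewrite mnmE ffunE inordK //; exact: an.
rewrite (bigD1 [ffun i => inord (a i)]) //= !aE eqxx mul1r big1 ?addr0 // => b ba.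
case: eqP => [bE|]; last by rewrite mul0r.
case/eqP: ba; apply/ffunP => i; rewrite ffunE; apply: val_inj => /=.
by rewrite -bE mnmE inord_val.
Qed.

Lemma Omega_linear c f g n : Omega (mpsC d c * f + g) n = c * Omega f n + Omega g n.
Proof.
rewrite /Omega mulr_sumr -big_split; apply: eq_bigr => a _.
by rewrite mpsD mpsCM mulrDl mulrA.
Qed.

Lemma Omega_continuous f g n :
    (forall m : 'X_{1..d}, (forall i, m i <= n)%N -> f m = g m) -> Omega f n = Omega g n.
Proof.
move=> fg; apply: eq_bigr => a _; rewrite fg // => i.
by rewrite mnmE -ltnS.
Qed.

End Omega.

(* ** Additive characters, cones, and the series G, F and F_N *)

(* An element of X(c); xi is only relevant on ZE. *)
Definition additive_character (R : realType) (E : fieldExtType rat)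
    (c : set E) (xi : E -> R[i]) :=
  [/\ forall x, ZE x -> xi x != 0,
      forall x y, ZE x -> ZE y -> xi (x + y) = xi x * xi y &
      forall x, c x -> xi x = 1].

Definition nontrivial_character (R : realType) (E : fieldExtType rat)
    (xi : E -> R[i]) := exists2 x, ZE x & xi x != 1.

(* Q(xi): the smallest subfield of R[i] containing the values of xi. *)
Definition Qxi (R : realType) (E : fieldExtType rat) (xi : E -> R[i]) :
    set R[i] :=
  [set z | forall S : divringClosed R[i],
             (forall x, ZE x -> xi x \in S) -> z \in S].

(* A presentation C(beta; lambda_1, ..., lambda_g). *)
Record cone (E : fieldExtType rat) (g : nat) :=
  Cone { base : E; gens : 'I_g -> E }.

Section Cones.
Variables (E : fieldExtType rat) (g : nat).
Implicit Type C : cone E g.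

Definition cone_point C (n : 'I_g -> nat) : E :=
  base C + \sum_i gens C i *+ n i.

Definition cone_set C : set E := range (cone_point C).

Definition is_cone (R : realType) d (s : 'I_d -> {rmorphism E -> R})
    (a : set E) C :=
  [/\ (1 <= g <= d)%N, (a `&` ZEplus s) (base C),
      forall i, (a `&` ZEplus s) (gens C i) &
      free [seq gens C i | i <- enum 'I_g]].

Definition admissible (c : set E) C := forall i, ~ c (gens C i).

End Cones.

Section Series.
Variables (R : realType) (d : nat).

(* r (r - 1) ... (r - n + 1) / n! *)
Definition gbinom (r : R[i]) (n : nat) : R[i] :=
  (\prod_(j < n) (r - j%:R)) / n`!%:R.

(* The series \sum_n u_n T_i^n. *)
Definition mps_var (i : 'I_d) (u : nat -> R[i]) : mps d R[i] :=
  MPS (fun m => if m == (U_(i) *+ m i)%MM then u (m i) else 0).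

Variables (E : fieldExtType rat) (s : 'I_d -> {rmorphism E -> R}).

(* (1 + T)^x in several variables *)
Definition onepT_pow (x : E) : mps d R[i] :=
  \prod_(i < d) mps_var i (gbinom (s i x)%:C%C).

Variables (g : nat) (C : cone E g) (xi : E -> R[i]).

(* When xi(lambda_i) != 1 for every i, the denominator is a unit of the ring
   of power series. *)
Definition G_series : mps d R[i] :=
  mpsC d (xi (base C)) * onepT_pow (base C) /
  \prod_(i < g) (1 - mpsC d (xi (gens C i)) * onepT_pow (gens C i)).

Definition F_series : nat -> R[i] := Omega G_series.

End Series.

(* The value at x != 1 of the rational function B_{k,K}; the rational function
   itself is the case L = Q(x). *)
Definition B_rat (L : fieldType) (k K : nat) (x : L) : L :=
  (-1) ^+ k * \sum_(k <= n < K.+1) 'C(n, k)%:R * (x / (x - 1)) ^+ n.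

Section FN.
Variables (R : realType) (E : fieldExtType rat) (g : nat).
Variables (C : cone E g) (xi : E -> R[i]).

Definition A_const : R[i] := xi (base C) / \prod_(i < g) (1 - xi (gens C i)).

(* For N = 0 the sum, over 0 <= k_i <= -d, is empty. *)
Definition F_N (d N : nat) : {poly R[i]} :=
  if N is M.+1 then
    A_const *: \sum_(k : {ffun 'I_g -> 'I_(M * d).+1})
           (\prod_(i < g) B_rat (k i) (M * d) (xi (gens C i))) *:
           (1 + 'X) ^+ abs_norm (cone_point C (fun i => k i))
  else 0.

Lemma F_N_over_Qxi d N : ZE (base C) -> (forall i, ZE (gens C i)) ->
  forall n, Qxi xi (F_N d N)`_n.
Proof.
move=> bZ gZ n S xiS; have bS := xiS _ bZ; have gS i := xiS _ (gZ i).
case: N => [|M]; first by rewrite coef0 rpred0.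
rewrite /F_N coefZ coef_sum /A_const; apply: rpredM.
  by apply: rpred_div => //; apply: rpred_prod => i _; rewrite rpredB ?rpred1.
apply: rpred_sum => k _; rewrite coefZ; apply: rpredM.
  apply: rpred_prod => i _; rewrite /B_rat rpredM ?rpredX ?rpredN1 //.
  apply: rpred_sum => m _; rewrite rpredM ?rpred_nat // rpredX //.
  by rewrite rpred_div // rpredB ?rpred1.
apply/(polyOverP (_ : _ \is a polyOver S)); rewrite rpredX // rpredD ?rpred1 //.
exact: polyOverX.
Qed.

End FN.

(* f = P mod T^N, for f : nat -> L the coefficients of a series. *)
Definition eq_mod_Tn (L : fieldType) (N : nat) (f : nat -> L) (P : {poly L}) :=
  forall n, (n < N)%N -> f n = P`_n.

(* Main.v *)
Require Import Defs.
From HB Require Import structures.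
From mathcomp Require Import all_boot all_order all_algebra all_field ring.
From mathcomp Require Import boolp classical_sets reals complex.
From mathcomp Require Import mpoly.

(** The coefficient of T^n in Omega(f), for n < N, only depends on the
    coefficients of f at monomials whose exponents are all at most N - 1, hence
    of total degree at most L = (N - 1) d.  So G may be replaced by any series
    with the same terms up to total degree L.

    Since no lambda_i lies in c and c has residual degree 1, the nontrivial
    character xi is different from 1 at each lambda_i ([char_neq1]).  With
    z = xi(lambda_i), x = z / (z - 1) and y = (1 + T)^lambda_i, the factor
    1 - z y of the denominator is (1 - z) (1 - x (1 - y)), where 1 - y has no
    constant term.  Its inverse is, up to degree L, the geometric series of
    x (1 - y) cut after the L-th power, divided by 1 - z; sorted by powers of y,
    that sum is \sum_k B_{k,L}(z) y^k ([B_rat_geometric]).  Multiplying over i,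
    G agrees up to degree L with
    A(C, xi) \sum_k (\prod_i B_{k_i,L}(xi(lambda_i))) (1 + T)^(beta + k.lambda)
    ([G_series_trunc]); this needs (1 + T)^x (1 + T)^y = (1 + T)^(x + y),
    which is Vandermonde's identity ([onepT_powD]).

    It remains that Omega sends (1 + T)^x to (1 + T)^N(x) for totally positive
    integral x ([Omega_onepT_pow]).  The coefficients of T^n on both sides are
    polynomials in the conjugates x_1, ..., x_d of x, of degree at most n in
    each; the equality is Newton's interpolation formula for
    binom(x_1 ... x_d, n) ([Omega_newton]).  It holds because a function which
    is polynomial of degree at most n in each variable is determined by its
    values on {0, ..., n}^d ([poly_in_each_eq]), and there the formula is
    binomial inversion ([bin_inversion]). *)

Set Implicit Arguments.
Unset Strict Implicit.
Unset Printing Implicit Defensive.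

Import Order.TTheory GRing.Theory Num.Theory.

Local Open Scope ring_scope.
Local Open Scope classical_set_scope.

(** * Binomial identities and sums over monomials *)

Lemma coef_1DZX_exp (K : comNzRingType) (c : K) j l :
  ((1 + c *: 'X) ^+ j)`_l = c ^+ l * 'C(j, l)%:R.
Proof.
rewrite exprDn coef_sum.
have tE (i : 'I_j.+1) : ((1 ^+ (j - i) * (c *: 'X) ^+ i) *+ 'C(j, i))`_l =
    if l == i then c ^+ l * 'C(j, l)%:R else 0 :> K.
  rewrite expr1n mul1r exprZn coefMn coefZ coefXn.
  by case: eqP => [->|_]; rewrite ?mulr1 ?mulr0 ?mul0rn // mulr_natr.
under eq_bigr => i _ do rewrite tE.
have [lj|lj] := leqP l j; last first.
  by rewrite bin_small // mulr0 big1 // => i _; case: eqP.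
rewrite (bigD1 (Ordinal (lj : l < j.+1)%N)) //= eqxx big1 ?addr0 // => i.
by rewrite -val_eqE eq_sym => /negbTE ->.
Qed.

(** Compare the coefficients of X^l in X^m = (1 - (1 - X))^m: the matrix of
    the polynomials (1 - X)^j in the basis X^l is its own inverse. *)
Lemma bin_inversion (K : comNzRingType) n m l : (m <= n)%N ->
  \sum_(j < n.+1) (-1) ^+ j * ((-1) ^+ l * 'C(j, l)%:R) * 'C(m, j)%:R =
  (m == l)%:R :> K.
Proof.
move=> mn; transitivity (('X : {poly K}) ^+ m)`_l; last first.
  by rewrite coefXn eq_sym.
have -> : 'X = 1 - (1 + (-1 : K) *: 'X) by rewrite scaleN1r opprB addrC subrK.
rewrite exprDn coef_sum (big_ord_widen n.+1
  (fun i => ((1 ^+ (m - i) * (- (1 + (-1 : K) *: 'X)) ^+ i) *+ 'C(m, i))`_l)) //.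
rewrite [RHS]big_mkcond /=; apply: eq_bigr => j _; case: ltnP => jm; last first.
  by rewrite [X in _ * X%:R]bin_small ?mulr0.
rewrite expr1n mul1r -[- (1 + _)]scaleN1r exprZn coefMn coefZ.
by rewrite coef_1DZX_exp mulr_natr.
Qed.

(** Monomials below m become functions into a fixed ordinal, the index sets over
    which sums of products factor (see [sum_mnm_le_prod]); any uniform bound L
    on the exponents will do, so that families with different m can share it. *)
Lemma sum_mnm_le (V : nmodType) d L k (m : 'X_{1..d}) (F : 'X_{1..d} -> V) :
    (forall i, (m i <= L)%N) -> (mdeg m < k)%N ->
  \sum_(l : 'X_{1..d < k} | (l <= m)%MM) F l =
  \sum_(b : {ffun 'I_d -> 'I_L.+1} |
      b \in family (fun i => [pred j : 'I_L.+1 | (j <= m i)%N]))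
    F [multinom (b i : nat) | i < d].
Proof.
move=> mL mk.
have le_deg (l : 'X_{1..d}) : (l <= m)%MM -> (mdeg l < k)%N.
  move=> /mnm_lepP lm; apply: leq_ltn_trans mk; rewrite !mdegE.
  by apply: leq_sum => i _; apply: lm.
have k0 : (mdeg (0%MM : 'X_{1..d}) < k)%N by rewrite mdeg0; case: (k) mk.
pose mn (b : {ffun 'I_d -> 'I_L.+1}) := [multinom (b i : nat) | i < d].
pose h b : 'X_{1..d < k} := insubd (BMultinom k0) (mn b).
have hE b : (mn b <= m)%MM -> h b = mn b :> 'X_{1..d}.
  by move=> /le_deg bm; rewrite /h insubdK.
have famE b : (b \in family (fun i => [pred j : 'I_L.+1 | (j <= m i)%N])) =
    (mn b <= m)%MM.
  by apply/familyP/mnm_lepP => bm i; have := bm i; rewrite mnmE inE.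
rewrite [RHS](reindex_onto (fun l : 'X_{1..d < k} =>
  [ffun i => inord ((l : 'X_{1..d}) i)]) h) /=; last first.
  move=> b; rewrite famE => bm; apply/ffunP => i; rewrite ffunE hE // mnmE.
  by rewrite inord_val.
have lE (l : 'X_{1..d}) : (l <= m)%MM -> mn [ffun i => inord (l i)] = l.
  move=> /mnm_lepP lm; apply/mnmP => i; rewrite mnmE ffunE inordK //.
  by rewrite ltnS (leq_trans (lm i)).
have lek (l : 'X_{1..d < k}) i : ((l : 'X_{1..d}) i <= m i)%N ->
    (inord ((l : 'X_{1..d}) i) : 'I_L.+1) = (l : 'X_{1..d}) i :> nat.
  by move=> li; rewrite inordK // ltnS (leq_trans li).
apply: eq_big => [l|l lm]; last by rewrite -/(mn _) lE.
rewrite famE; apply/idP/andP => [lm|[lm /eqP lE']].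
  by rewrite lE //; split=> //; apply/eqP/val_inj => /=; rewrite hE lE.
by move: (congr1 val lE'); rewrite /= hE // => <-.
Qed.

Lemma sum_mnm_le_prod (K : comNzRingType) d k (m : 'X_{1..d})
    (F : 'I_d -> nat -> K) : (mdeg m < k)%N ->
  \sum_(l : 'X_{1..d < k} | (l <= m)%MM) \prod_i F i ((l : 'X_{1..d}) i) =
  \prod_i \sum_(j < (m i).+1) F i j.
Proof.
move=> mk; have mL i : (m i <= mdeg m)%N by rewrite mdegE (bigD1 i) ?leq_addr.
rewrite (sum_mnm_le (fun l => \prod_i F i (l i)) mL mk).
rewrite [RHS](eq_bigr (fun i =>
    \sum_(j < (mdeg m).+1 | [pred j : 'I_(mdeg m).+1 | (j <= m i)%N] j) F i j)).
  rewrite bigA_distr_big_dep; apply: eq_bigr => b _.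
  by apply: eq_bigr => i _; rewrite mnmE.
move=> i _; rewrite (big_ord_widen (mdeg m).+1 (F i)) ?ltnS //.
Qed.

(** * Interpolation at small natural numbers *)

Section Interpolation.
Variables (K : numFieldType) (d n : nat).
Implicit Types (x : 'I_d -> K) (F G : ('I_d -> K) -> K).

Definition subst_coord x (i : 'I_d) (t : K) : 'I_d -> K :=
  fun k => if k == i then t else x k.

(** Polynomiality in one coordinate at a time is enough for interpolation on a
    grid, and spares the construction of a multivariate polynomial. *)
Definition poly_in_each F := forall i x,
  exists2 p : {poly K}, (size p <= n.+1)%N &
    forall t, F (subst_coord x i t) = p.[t].

Lemma poly_eq_on_nat (p q : {poly K}) :
    (size p <= n.+1)%N -> (size q <= n.+1)%N ->
  (forall m, (m <= n)%N -> p.[m%:R] = q.[m%:R]) -> p = q.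
Proof.
move=> pn qn pq; apply/eqP; rewrite -subr_eq0; apply: contraT => pq0.
have rtP : all (root (p - q)) [seq m%:R | m <- iota 0 n.+1].
  apply/allP => _ /mapP[m mn ->]; rewrite /root hornerD hornerN pq ?subrr //.
  by rewrite mem_iota in mn.
have := max_poly_roots pq0 rtP; rewrite size_map size_iota ltnNge.
rewrite (leq_trans (size_polyD _ _)) ?geq_max ?size_polyN ?pn ?qn //; apply.
by rewrite map_inj_uniq ?iota_uniq // => i j /eqP; rewrite eqr_nat => /eqP.
Qed.

(** The grid {0, ..., n}^d determines such a function: the coordinates are
    released from the grid one at a time, each by [poly_eq_on_nat]. *)
Lemma poly_in_each_eq F G : poly_in_each F -> poly_in_each G ->
  (forall m : 'I_d -> nat, (forall i, (m i <= n)%N) ->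
     F (fun i => (m i)%:R) = G (fun i => (m i)%:R)) -> F =1 G.
Proof.
move=> Fp Gp FG.
(* Only the coordinates of index at least j are still on the grid. *)
suff FGj j : (j <= d)%N -> forall x, (forall i : 'I_d, (j <= i)%N ->
    exists2 m, (m <= n)%N & x i = m%:R) -> F x = G x.
  by move=> x; apply: (FGj d) => // i; rewrite leqNgt ltn_ord.
elim: j => [_ x xn|j IHj jd x xn].
  pose m i := projT1 (cid2 (xn i isT)).
  have mP i : (m i <= n)%N /\ x i = (m i)%:R by rewrite /m; case: cid2.
  have -> : x = fun i => (m i)%:R by apply: funext => i; case: (mP i).
  by apply: FG => i; case: (mP i).
pose i := Ordinal jd.
have xE : x = subst_coord x i (x i).
  by apply: funext => k; rewrite /subst_coord; case: eqP => [->|].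
have [p pn pE] := Fp i x; have [q qn qE] := Gp i x.
rewrite xE pE qE; congr (_.[_]); apply: poly_eq_on_nat => // m mn.
rewrite -pE -qE; apply: IHj; first exact: ltnW.
move=> k jk; rewrite /subst_coord; case: eqP => [_|/eqP ki]; first by exists m.
by apply: xn; rewrite ltn_neqAle jk andbT eq_sym -(inj_eq val_inj) in ki *.
Qed.

End Interpolation.

(** * The binomial series (1 + T)^x *)

Section BinomialSeries.
Variable R : realType.
Local Notation K := (R[i]).

Definition gbinom_poly n : {poly K} := n`!%:R^-1 *: \prod_(j < n) ('X - j%:R%:P).

Lemma size_gbinom_poly n : (size (gbinom_poly n) <= n.+1)%N.
Proof.
rewrite (leq_trans (size_scale_leq _ _)) // size_prod_XsubC.
by rewrite /index_enum -enumT size_enum_ord.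
Qed.

Lemma horner_gbinom_poly n t : (gbinom_poly n).[t] = gbinom t n.
Proof.
rewrite hornerZ horner_prod mulrC; congr (_ / _).
by apply: eq_bigr => j _; rewrite hornerXsubC.
Qed.

Lemma gbinom_nat m n : gbinom (m%:R : K) n = 'C(m, n)%:R.
Proof.
have n0 : n`!%:R != 0 :> K by rewrite pnatr_eq0 -lt0n fact_gt0.
apply: (mulIf n0); rewrite divfK // -natrM bin_ffact ffact_prod natr_prod.
have [nm|mn] := leqP n m.
  by apply: eq_bigr => j _; rewrite natrB // ltnW // (leq_trans (ltn_ord j)).
rewrite (bigD1 (Ordinal mn)) //= subrr mul0r [RHS](bigD1 (Ordinal mn)) //=.
by rewrite subnn mul0r.
Qed.

(** Vandermonde's identity for natural numbers extends to all arguments, since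
    both sides have degree at most n in x and in y. *)
Lemma gbinomD x y n :
  gbinom (x + y) n = \sum_(j < n.+1) gbinom x j * gbinom y (n - j) :> K.
Proof.
pose P z := gbinom_poly n \Po ('X + z%:P).
pose Q z := \sum_(j < n.+1) gbinom z j *: gbinom_poly (n - j).
have Pn z : (size (P z) <= n.+1)%N.
  apply: leq_trans (size_comp_poly_leq _ _) _.
  by rewrite size_XaddC muln1 ltnS -subn1 leq_subLR size_gbinom_poly.
have Qn z : (size (Q z) <= n.+1)%N.
  apply: (leq_trans (size_sum _ _ _)); apply/bigmax_leqP => j _.
  apply: leq_trans (size_scale_leq _ _) _.
  by apply: leq_trans (size_gbinom_poly _) _; rewrite ltnS leq_subr.
have PE z t : (P z).[t] = gbinom (t + z) n.
  by rewrite horner_comp hornerD hornerX hornerC horner_gbinom_poly.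
have QE z t : (Q z).[t] = \sum_(j < n.+1) gbinom z j * gbinom t (n - j).
  by rewrite horner_sum; apply: eq_bigr => j _; rewrite hornerZ horner_gbinom_poly.
(* First x varies with y a natural number, then the roles are exchanged. *)
have PQ m : P m%:R = Q m%:R.
  apply: (poly_eq_on_nat (Pn _) (Qn _)) => l _; rewrite PE QE -natrD gbinom_nat.
  rewrite addnC -binomial.Vandermonde natr_sum; apply: eq_bigr => j _.
  by rewrite !gbinom_nat natrM.
have sym z t : (Q z).[t] = (Q t).[z].
  rewrite !QE (reindex_inj rev_ord_inj); apply: eq_bigr => j _.
  have jn : (j <= n)%N by rewrite -ltnS.
  by rewrite [rev_ord _ : nat]/= subSS (subKn jn) mulrC.
suff PQy : P y = Q y by rewrite -PE PQy sym QE.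
apply: (poly_eq_on_nat (Pn _) (Qn _)) => m _.
by rewrite sym -PQ !PE addrC.
Qed.

(** A product of series in separate variables has product coefficients.  The
    induction multiplies the variables in one by one: a partial product only
    has monomials in the variables of r, which leaves a single term of the
    Cauchy product. *)
Lemma mps_prod_var_coef d (u : 'I_d -> nat -> K) (m : 'X_{1..d}) :
  (\prod_i mps_var i (u i)) m = \prod_i u i (m i).
Proof.
pose supp (r : seq 'I_d) (m : 'X_{1..d}) :=
  [forall i, (i \notin r) ==> (m i == 0%N)].
suff H r : uniq r -> (\prod_(i <- r) mps_var i (u i)) m =
    if supp r m then \prod_(i <- r) u i (m i) else 0.
  rewrite H ?index_enum_uniq //; case: ifPn => //.
  rewrite /supp => /fintype.forallPn[j].
  by rewrite negb_imply mem_index_enum.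
elim: r m => [m _|j r IHr m /= /andP[jr r_uniq]].
  rewrite !big_nil mps1E; have -> : (m == 0%MM) = supp [::] m;
    last by case: (supp _ _).
  apply/eqP/forallP => [-> i|m0]; first by rewrite mnm0E.
  by apply/mnmP => i; have /eqP := m0 i; rewrite mnm0E.
rewrite !big_cons mpsM.
pose k0 : 'X_{1..d} := (U_(j) *+ m j)%MM.
have k0E i : k0 i = if i == j then m j else 0%N.
  by rewrite mulmnE mnm1E eq_sym; case: eqP => _;
     rewrite ?mul1n ?mul0n ?muln1 ?muln0.
have k0m : (k0 <= m)%MM.
  by apply/mnm_lepP => i; rewrite k0E; case: eqP => [->|].
have k0deg : (mdeg k0 < (mdeg m).+1)%N.
  by rewrite ltnS !mdegE; apply: leq_sum => i _; have /mnm_lepP := k0m.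
rewrite (bigD1 (BMultinom k0deg)) //= [X in _ + X]big1 ?addr0 => [|k /andP[km kk0]].
  rewrite [k0 j]k0E !eqxx IHr //.
  have mk i : (m - k0)%MM i = if i == j then 0%N else m i.
    by rewrite mnmBE k0E; case: eqP => [->|_]; rewrite ?subnn ?subn0.
  have -> : supp r (m - k0)%MM = supp (j :: r) m.
    apply: eq_forallb => i; rewrite mk inE; case: (i =P j) => [->|_] //=.
    by rewrite jr.
  case: ifP => _; last by rewrite mulr0.
  congr (_ * _); apply: eq_big_seq => i ir; rewrite mk.
  by case: eqP => // ij; rewrite -ij ir in jr.
case: eqP => [kE|]; last by rewrite mul0r.
rewrite IHr // ifN ?mulr0 // /supp negb_forall; apply/existsP; exists j.
rewrite negb_imply jr /= mnmBE subn_eq0 -ltnNge ltn_neqAle.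
have /mnm_lepP -> := km; rewrite andbT; apply: contra kk0 => /eqP kj.
by rewrite -val_eqE /= {1}kE kj.
Qed.

Section OnePlusT.
Variables (E : fieldExtType rat) (d : nat) (s : 'I_d -> {rmorphism E -> R}).

Lemma onepT_pow_coef x (m : 'X_{1..d}) :
  onepT_pow s x m = \prod_i gbinom (s i x)%:C%C (m i).
Proof. exact: mps_prod_var_coef. Qed.

Lemma onepT_pow_coef0 x : onepT_pow s x 0%MM = 1.
Proof.
rewrite onepT_pow_coef big1 // => i _.
by rewrite mnm0E /gbinom big_ord0 fact0 divr1.
Qed.

Lemma onepT_powD x y : onepT_pow s (x + y) = onepT_pow s x * onepT_pow s y.
Proof.
apply: mpsP => m; rewrite mpsM onepT_pow_coef.
pose F i j := gbinom (s i x)%:C%C j * gbinom (s i y)%:C%C (m i - j).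
transitivity (\prod_i \sum_(j < (m i).+1) F i j).
  by apply: eq_bigr => i _; rewrite rmorphD /= rmorphD gbinomD.
rewrite -(sum_mnm_le_prod F (ltnSn _)); apply: eq_bigr => k _.
rewrite !onepT_pow_coef -big_split; apply: eq_bigr => i _.
by rewrite mnmBE.
Qed.

Lemma onepT_powMn x n : onepT_pow s (x *+ n) = onepT_pow s x ^+ n.
Proof.
elim: n => [|n IHn]; last by rewrite mulrS exprS onepT_powD IHn.
apply: mpsP => m; rewrite expr0 mulr0n onepT_pow_coef mps1E.
under eq_bigr => i _ do rewrite rmorph0 [_%:C%C](_ : _ = 0%:R) // gbinom_nat.
case: eqP => [->|/eqP m0].
  by rewrite big1 // => i _; rewrite mnm0E.
have [i mi] : exists i, m i != 0%N.
  by apply: contrapT => /forallNP m0'; case/eqP: m0; apply/mnmP => i;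
     rewrite mnm0E; have /negP/negPn/eqP := m0' i.
by rewrite (bigD1 i) //= bin_small ?mul0r ?lt0n.
Qed.

Lemma onepT_pow_sum x (I : finType) (y : I -> E) (k : I -> nat) :
  onepT_pow s (x + \sum_i y i *+ k i) =
  onepT_pow s x * \prod_i onepT_pow s (y i) ^+ k i.
Proof.
rewrite onepT_powD; congr (_ * _).
elim/big_rec2: _ => [|i p w _ <-]; last by rewrite onepT_powD onepT_powMn.
by rewrite -(expr0 (onepT_pow s 0)) -onepT_powMn mulr0n.
Qed.

End OnePlusT.

End BinomialSeries.

(** * Omega turns (1 + T)^x into (1 + T)^N(x) *)

Section OmegaBinomial.
Variable R : realType.
Local Notation K := (R[i]).

Lemma Omega_monomial_family d n (a : 'X_{1..d}) : (forall i, (a i <= n)%N) ->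
  (Omega_monomial K a)`_n = \sum_(l : {ffun 'I_d -> 'I_n.+1})
    (\prod_i ((-1) ^+ a i * ((-1) ^+ l i * 'C(a i, l i)%:R))) *
    'C(\prod_i l i, n)%:R.
Proof.
move=> an; rewrite /Omega_monomial coefZ.
rewrite (sum_mnm_le (fun l : 'X_{1..d} =>
  (\prod_i ((-1) ^+ l i * 'C(a i, l i)%:R)) *:
    ((1 + 'X) ^+ (\prod_i l i)%N : {poly K})) an (ltnSn _)).
rewrite coef_sum mulr_sumr big_mkcond /=; apply: eq_bigr => l _.
under [in (\prod_i _)%N]eq_bigr => i _ do rewrite mnmE.
under [in (_ *: _)]eq_bigr => i _ do rewrite mnmE.
have signE : (-1) ^+ mdeg a = \prod_i (-1) ^+ a i :> K.
  by rewrite mdegE; elim/big_rec2: _ => [|i p q _ <-]; rewrite ?expr0 // exprD.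
rewrite coefZ -['X]scale1r coef_1DZX_exp expr1n mul1r mulrA signE -big_split /=.
case: ifPn => // /familyP la; rewrite [in RHS](_ : \prod_i _ = 0) ?mul0r //.
have [i li] : exists i, (a i < l i)%N.
  by apply: contrapT => /forallNP la'; case: la => i; rewrite inE leqNgt;
     apply/negP/la'.
by rewrite (bigD1 i) //= bin_small ?mulr0 ?mul0r.
Qed.

(** This is Newton's interpolation formula for the function
    x |-> binom(x_1 ... x_d, n), which has degree at most n in each x_i: the
    coefficient of T^n in Omega(T^a) is its a-th iterated difference at 0.  It
    suffices to compare both sides on the grid {0, ..., n}^d, where the formula
    is binomial inversion in each coordinate. *)
Lemma Omega_newton d n (x : 'I_d -> K) :
  \sum_(a : {ffun 'I_d -> 'I_n.+1}) (\prod_i gbinom (x i) (a i)) *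
    (Omega_monomial K [multinom (a i : nat) | i < d])`_n =
  gbinom (\prod_i x i) n.
Proof.
pose F (x : 'I_d -> K) := \sum_(a : {ffun 'I_d -> 'I_n.+1})
  (\prod_i gbinom (x i) (a i)) *
  (Omega_monomial K [multinom (a i : nat) | i < d])`_n.
pose G (x : 'I_d -> K) := gbinom (\prod_i x i) n.
suff : F =1 G by apply.
apply: (@poly_in_each_eq _ d n) => {x} [i x|i x|m mn].
- exists (\sum_(a : {ffun 'I_d -> 'I_n.+1})
    ((\prod_(k | k != i) gbinom (x k) (a k)) *
      (Omega_monomial K [multinom (a i : nat) | i < d])`_n) *:
    gbinom_poly R (a i)).
    apply: (leq_trans (size_sum _ _ _)); apply/bigmax_leqP => a _.
    apply: leq_trans (size_scale_leq _ _) _.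
    by apply: leq_trans (size_gbinom_poly _ _) _; rewrite ltn_ord.
  move=> t; rewrite horner_sum; apply: eq_bigr => a _.
  rewrite hornerZ horner_gbinom_poly (bigD1 i) //= /subst_coord eqxx.
  rewrite -mulrA mulrC; congr (_ * _ * _).
  by apply: eq_bigr => k /negbTE ->.
- exists (gbinom_poly R n \Po ((\prod_(k | k != i) x k) *: 'X)).
    apply: leq_trans (size_comp_poly_leq _ _) _; rewrite ltnS.
    have sX : ((size ((\prod_(k | k != i) x k) *: 'X)).-1 <= 1)%N.
      by rewrite -subn1 leq_subLR (leq_trans (size_scale_leq _ _)) ?size_polyX.
    apply: leq_trans (leq_mul (leqnn _) sX) _.
    by rewrite muln1 -subn1 leq_subLR size_gbinom_poly.
  move=> t; rewrite horner_comp horner_gbinom_poly hornerZ hornerX /G.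
  congr (gbinom _ n); rewrite (bigD1 i) //= /subst_coord eqxx mulrC.
  by congr (_ * _); apply: eq_bigr => k /negbTE ->.
rewrite /F /G.
transitivity (\sum_(l : {ffun 'I_d -> 'I_n.+1}) \sum_(a : {ffun 'I_d -> 'I_n.+1})
  (\prod_i ((-1) ^+ a i * ((-1) ^+ l i * 'C(a i, l i)%:R) * 'C(m i, a i)%:R)) *
  'C(\prod_i l i, n)%:R : K).
  rewrite exchange_big; apply: eq_bigr => a _ /=.
  rewrite Omega_monomial_family => [|i]; last by rewrite mnmE -ltnS.
  rewrite mulr_sumr; apply: eq_bigr => l _; rewrite mulrA -big_split /=.
  congr (_ * _); apply: eq_bigr => i _; rewrite gbinom_nat mnmE.
  by rewrite mulrC.
pose m' := [ffun i => inord (m i)] : {ffun 'I_d -> 'I_n.+1}.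
have m'E i : m' i = m i :> nat by rewrite ffunE inordK // ltnS.
transitivity (\sum_(l : {ffun 'I_d -> 'I_n.+1})
  (\prod_i (m i == l i)%:R) * 'C(\prod_i l i, n)%:R : K).
  apply: eq_bigr => l _; rewrite -mulr_suml -(bigA_distr_bigA
    (fun i (j : 'I_n.+1) => (-1) ^+ j * ((-1) ^+ l i * 'C(j, l i)%:R) * 'C(m i, j)%:R)).
  by congr (_ * _); apply: eq_bigr => i _; rewrite bin_inversion.
rewrite (bigD1 m') //= [X in _ + X]big1 ?addr0 => [|l lm].
  rewrite big1 ?mul1r => [|i _]; last by rewrite m'E eqxx.
  rewrite -natr_prod gbinom_nat; congr ('C(_, _))%:R.
  by apply: eq_bigr => i _; rewrite m'E.
have [i mi] : exists i, m i != l i.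
  apply: contrapT => /forallNP ml; case/eqP: lm; apply/ffunP => i.
  by apply: val_inj; rewrite /= m'E; have /negP/negPn/eqP := ml i.
by rewrite (bigD1 i) //= (negbTE mi) !mul0r.
Qed.

(** The norm enters here, as the product of the conjugates. *)
Lemma Omega_onepT_pow (E : fieldExtType rat) d (s : 'I_d -> {rmorphism E -> R})
    x n : d = \dim {:E} -> (forall i j, s i =1 s j -> i = j) -> ZEplus s x ->
  Omega (onepT_pow s x) n = ((1 + 'X) ^+ abs_norm x : {poly K})`_n.
Proof.
move=> dE s_inj x_pos; rewrite -['X]scale1r coef_1DZX_exp expr1n mul1r.
rewrite -gbinom_nat; have -> : (abs_norm x)%:R = \prod_i (s i x)%:C%C :> K.
  by rewrite -rmorph_prod -(abs_normE dE s_inj x_pos) rmorph_nat.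
rewrite -Omega_newton; apply: eq_bigr => a _; rewrite onepT_pow_coef.
by congr (_ * _); apply: eq_bigr => i _; rewrite mnmE.
Qed.

End OmegaBinomial.

(** * Geometric series up to a given total degree *)

Section ConstantSeries.
Variables (d : nat) (K : comNzRingType).

Fact mpsC_is_zmod_morphism : zmod_morphism (@mpsC d K).
Proof.
move=> a b; apply: mpsP => m; rewrite mpsD mpsN /=.
by case: (_ == _); rewrite ?subr0.
Qed.
HB.instance Definition _ :=
  GRing.isZmodMorphism.Build K (mps d K) (@mpsC d K) mpsC_is_zmod_morphism.

Fact mpsC_is_monoid_morphism : monoid_morphism (@mpsC d K).
Proof. by split=> // a b; rewrite mpsCMC. Qed.
HB.instance Definition _ :=
  GRing.isMonoidMorphism.Build K (mps d K) (@mpsC d K) mpsC_is_monoid_morphism.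

End ConstantSeries.

Section Truncation.
Variables (d : nat) (L : nat).

Definition eq_upto (K : Type) (f h : mps d K) :=
  forall m : 'X_{1..d}, (mdeg m <= L)%N -> f m = h m.

Lemma eq_uptoM (K : comNzRingType) (f f' h h' : mps d K) :
  eq_upto f f' -> eq_upto h h' -> eq_upto (f * h) (f' * h').
Proof.
move=> ff' hh' m mL; rewrite !mpsM; apply: eq_bigr => k km.
rewrite ff' ?hh' //; first by rewrite (leq_trans (mdegB _ _)).
by rewrite (leq_trans _ mL) // -ltnS bmdeg.
Qed.

Lemma eq_upto_prod (K : comNzRingType) (I : finType) (f h : I -> mps d K) :
  (forall i, eq_upto (f i) (h i)) -> eq_upto (\prod_i f i) (\prod_i h i).
Proof.
move=> fh; elim/big_rec2: _ => [m //|i p q _ pq].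
exact: eq_uptoM.
Qed.

(** The numbers B_{k,L}(z) are the coefficients in the powers of y of a truncated
    geometric series.  With x = z / (z - 1) and w = x (1 - y) one has
    1 - z y = (1 - z) (1 - w), and expanding the powers of 1 - y in
    1 + w + ... + w^L gives \sum_k B_{k,L}(z) y^k.  As w has no constant term,
    the error w^(L+1) only has monomials of degree greater than L. *)
Lemma B_rat_geometric (K : fieldType) (z : K) (y : mps d K) :
    z != 1 -> y 0%MM = 1 ->
  eq_upto (mpsC d (1 - z)^-1 * (\sum_(k < L.+1) mpsC d (B_rat k L z) * y ^+ k) *
           (1 - mpsC d z * y)) 1.
Proof.
move=> z1 y0; pose x := z / (z - 1); pose w := mpsC d x * (1 - y).
have z1' : 1 - z != 0 by rewrite subr_eq0 eq_sym.
have zE : 1 - mpsC d z * y = mpsC d (1 - z) * (1 - w).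
  have xz : (1 - z) * x = - z.
    by rewrite /x -(opprB z 1) mulNr mulrCA divff ?mulr1 // subr_eq0.
  rewrite mulrBr mulr1 /w mulrA -rmorphM xz rmorphB rmorph1 rmorphN.
  by rewrite mulNr opprK mulrBr mulr1 addrA subrK.
have sumE :
    \sum_(k < L.+1) mpsC d (B_rat k L z) * y ^+ k = \sum_(n < L.+1) w ^+ n.
  transitivity (\sum_(k < L.+1) \sum_(n < L.+1)
      mpsC d (x ^+ n) * (((- y) ^+ k) *+ 'C(n, k))).
    apply: eq_bigr => k _; rewrite /B_rat -/x.
    rewrite (big_nat_widenl _ 0) // big_mkcond /= big_mkord.
    rewrite rmorphM rmorph_sum /= mulr_sumr mulr_suml; apply: eq_bigr => n _.
    case: leqP => kn; last by rewrite bin_small ?mulr0n // rmorph0 !mulr0 mul0r.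
    rewrite !rmorphM /= rmorphXn rmorphN1 rmorph_nat (exprNn y) -mulr_natl.
    by rewrite mulr1 -mulr_natl; ring.
  rewrite exchange_big /=; apply: eq_bigr => n _; rewrite [RHS]exprMn -rmorphXn.
  rewrite -mulr_sumr addrC exprD1n; congr (_ * _).
  rewrite [RHS](big_ord_widen L.+1 (fun i => (- y) ^+ i *+ 'C(n, i))) //.
  rewrite [RHS]big_mkcond; apply: eq_bigr => i _.
  by case: ltnP => // ni; rewrite bin_small.
have w0 : w 0%MM = 0 by rewrite mpsCM mpsD mpsN mps1E eqxx y0 subrr mulr0.
rewrite zE sumE mulrACA -rmorphM mulVf // rmorph1 mul1r mulrC.
rewrite -opprB mulNr -subrX1 opprB => m mL.
by rewrite mpsD mpsN mps_expr_low // subr0.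
Qed.

End Truncation.

(** * Nontrivial characters modulo a prime of degree 1 *)

Section ResidueField.
Variables (R : realType) (E : fieldExtType rat).

Lemma ZED (x y : E) : ZE x -> ZE y -> ZE (x + y).
Proof. exact: (@integral_add _ _ (intr : {rmorphism int -> E})). Qed.

Lemma ZEN (x : E) : ZE x -> ZE (- x).
Proof. exact: (@integral_opp _ _ (intr : {rmorphism int -> E})). Qed.

Lemma ZEn n : ZE (n%:R : E).
Proof. exact: (@integral_nat _ _ (intr : {rmorphism int -> E})). Qed.

Lemma ZEMn (x : E) n : ZE x -> ZE (x *+ n).
Proof.
move=> xZ; rewrite -mulr_natl.
by apply: (@integral_mul _ _ (intr : {rmorphism int -> E})) => //; apply: ZEn.
Qed.

(** The quotient ZE / c has prime order nc, so it is generated by any x outside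
    c: the multiples 0, x, ..., (nc - 1) x are pairwise incongruent, hence
    represent every class.  If xi x = 1, then xi would be trivial. *)
Lemma char_neq1 (c : set E) nc (xi : E -> R[i]) (x : E) :
    prime_ideal c -> residual_degree_is c nc 1 -> additive_character c xi ->
    nontrivial_character xi -> ZE x -> ~ c x ->
  xi x != 1.
Proof.
move=> [[cZ _ cD cM] c1 c_prime] [nc_prime c_nc]; rewrite expn1.
move=> [r [_ r_rep]] [_ xiD xi1] [y yZ xiy] xZ xNc.
have cN u : c u -> c (- u) by rewrite -mulN1r; apply: cM; apply/ZEN/(ZEn 1).
have cB u v : c u -> c v -> c (u - v) by move=> uc /cN; apply: cD.
(* A residue prime to nc is invertible modulo c, by Bezout. *)
have c_nat n : (0 < n < nc)%N -> ~ c n%:R.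
  move=> /andP[n0 n_lt] c_n; apply: c1.
  have : coprime n nc by rewrite coprime_sym prime_coprime // gtnNdvd.
  move=> /eqP g1; have [u v uv _] := egcdnP nc n0; rewrite g1 in uv.
  have -> : 1 = u%:R * n%:R - v%:R * nc%:R :> E.
    by rewrite -!natrM uv natrD addrAC subrr add0r.
  by apply: cB; apply: cM => //; apply: ZEn.
have rep_uniq u i j : ZE u -> c (u - r i) -> c (u - r j) -> i = j.
  by move=> /r_rep[k [_ k_uniq]] /k_uniq <- /k_uniq <-.
(* The index of the class of n x; an injection of 'I_nc, hence onto. *)
have /(_ _)/cid h := r_rep (x *+ _) (ZEMn _ xZ).
pose h' (n : 'I_nc) := projT1 (h n).
have h'P (n : 'I_nc) : c (x *+ n - r (h' n)) by rewrite /h'; case: (h n) => i [].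
have lt_neq (m n : 'I_nc) : (m < n)%N -> h' m != h' n.
  move=> mn; apply/eqP => hmn; have := cB _ _ (h'P n) (h'P m); rewrite hmn.
  rewrite opprB addrA subrK -mulrnBr ?(ltnW mn) // -mulr_natl.
  move=> cnx; case: (c_prime _ _ (ZEn _) xZ cnx) => [|//].
  apply: c_nat; rewrite subn_gt0 mn (leq_ltn_trans _ (ltn_ord n)) //.
  exact: leq_subr.
have h'_inj : injective h'.
  move=> m n /eqP hmn; apply: val_inj => /=.
  by case: (ltngtP m n) => // /lt_neq; rewrite ?hmn // eq_sym hmn.
have [i [yi _]] := r_rep _ yZ.
have [k _ hk] : exists2 k, k \in 'I_nc & h' k = i.
  by exists (invF h'_inj i); rewrite ?f_invF.
apply/eqP => xix; case/eqP: xiy.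
have yx : c (y - x *+ k).
  by have := cB _ _ yi (h'P k); rewrite hk opprB addrA subrK.
rewrite -(subrK (x *+ k) y) xiD ?(xi1 _ yx) ?mul1r; [|exact: cZ|exact: ZEMn].
elim: (k : nat) => [|n IHn]; last first.
  by rewrite mulrS xiD ?xix ?IHn ?mulr1 //; apply: ZEMn.
by rewrite mulr0n xi1 // -(subrr (y - x *+ k)); apply: cB.
Qed.

End ResidueField.

(** * The series G up to total degree L *)

Section TruncatedSeries.
Variables (R : realType) (E : fieldExtType rat) (d : nat).
Variables (s : 'I_d -> {rmorphism E -> R}).
Variables (g : nat) (C : cone E g) (xi : E -> R[i]).

(** Each factor of the denominator of G is inverted by [B_rat_geometric]; the
    product of these inverses expands into a sum over the k in {0, ..., L}^g, and
    the powers of (1 + T)^lambda_i combine with (1 + T)^beta to the cone point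
    beta + k.lambda. *)
Lemma G_series_trunc L : (forall i, xi (gens C i) != 1) ->
  eq_upto L (G_series s C xi)
    (\sum_(k : {ffun 'I_g -> 'I_L.+1})
      mpsC d (A_const C xi * \prod_i B_rat (k i) L (xi (gens C i))) *
      onepT_pow s (cone_point C (fun i => k i))).
Proof.
move=> xi1; pose y i := onepT_pow s (gens C i); pose z i := xi (gens C i).
pose S i := mpsC d (1 - z i)^-1 *
  (\sum_(k < L.+1) mpsC d (B_rat k L (z i)) * y i ^+ k).
pose D := \prod_(i < g) (1 - mpsC d (z i) * y i).
have D_unit : D \is a GRing.unit.
  apply: rpred_prod => i _.
  suff : (1 - mpsC d (z i) * y i) 0%MM != 0 by [].
  rewrite mpsD mps1E eqxx mpsN mpsCM onepT_pow_coef0 mulr1.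
  by rewrite subr_eq0 eq_sym; apply: xi1.
have S_inv : eq_upto L (\prod_i S i * D) 1.
  have SE i : eq_upto L (S i * (1 - mpsC d (z i) * y i)) ((fun=> 1) i).
    by apply: B_rat_geometric; [exact: xi1 | exact: onepT_pow_coef0].
  rewrite -big_split; have := eq_upto_prod SE.
  by rewrite [\prod_i (fun=> 1) i]big1.
(* Congruences multiply, so an inverse modulo degree L of a unit is congruent
   to its inverse. *)
have invD : eq_upto L D^-1 (\prod_i S i).
  have : eq_upto L (\prod_i S i * D * D^-1) (1 * D^-1) by apply: eq_uptoM.
  by rewrite mulrK // mul1r => H m mL; rewrite H.
pose num := mpsC d (xi (base C)) * onepT_pow s (base C).
have -> : G_series s C xi = num * D^-1 by [].
have -> : \sum_(k : {ffun 'I_g -> 'I_L.+1})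
      mpsC d (A_const C xi * \prod_i B_rat (k i) L (xi (gens C i))) *
      onepT_pow s (cone_point C (fun i => k i)) = num * \prod_i S i.
  rewrite big_split bigA_distr_bigA /= -(rmorph_prod (@mpsC d R[i])) !mulr_sumr.
  apply: eq_bigr => k _.
  rewrite [X in _ = _ * (_ * X)]big_split /= -(rmorph_prod (@mpsC d R[i])).
  rewrite onepT_pow_sum /A_const -/z -prodfV !rmorphM /= /num.
  by rewrite -!mulrA; congr (_ * _); ring.
exact: eq_uptoM.
Qed.

Lemma Omega_sum (I : finType) (a : I -> R[i]) (u : I -> mps d R[i]) n :
  Omega (\sum_i mpsC d (a i) * u i) n = \sum_i a i * Omega (u i) n.
Proof.
elim/big_rec2: _ => [|i p v _ <-]; last by rewrite Omega_linear.
by rewrite /Omega big1 // => b _; rewrite mul0r.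
Qed.

Lemma ZEplus_cone_point (k : 'I_g -> nat) :
    ZEplus s (base C) -> (forall i, ZEplus s (gens C i)) ->
  ZEplus s (cone_point C k).
Proof.
move=> [bZ b0] gP; split.
  apply: ZED => //; elim/big_ind: _ => [|u v|i _]; [exact: (ZEn E 0) | exact: ZED |].
  by apply: ZEMn; case: (gP i).
move=> j; rewrite rmorphD rmorph_sum ltr_wpDr //; apply: sumr_ge0 => i _.
by rewrite rmorphMn mulrn_wge0 // ltW //; case: (gP i).
Qed.

End TruncatedSeries.

(** * The congruence *)

Theorem theorem4p1
  (R : realType)
  (* the prime p, and q *)
  (p q : nat) (p_prime : prime p) (qE : q = if p == 2%N then 4%N else p)
  (* the totally real field E of degree d, and its real embeddings *)
  (E : fieldExtType rat) (d : nat) (dE : d = \dim {:E})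
  (E_real : totally_real E R)
  (s : 'I_d -> {rmorphism E -> R}) (s_emb : real_embeddings s)
  (* the modulus f z: z is a set of real places containing all of them *)
  (f : set E) (f_ideal : integral_ideal f) (q_dvd_f : ideal_divisible_by f q)
  (z : {set 'I_d}) (z_all : forall i, i \in z)
  (* the prime ideal c, of norm nc, and the ideal a *)
  (c : set E) (nc : nat) (c_prime : prime_ideal c)
  (c_deg1 : residual_degree_is c nc 1) (c_f : coprime_ideals c f)
  (a : set E) (a_ideal : integral_ideal a)
  (a_c : coprime_ideals a c) (a_f : coprime_ideals a f)
  (* the cone C(beta; lambda_1, ..., lambda_g) *)
  (g : nat) (C : cone E g) (C_cone : is_cone s a C) (C_adm : admissible c C)
  (* the character xi *)
  (xi : E -> R[i]) (xi_char : additive_character c xi)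
  (xi_nontriv : nontrivial_character xi)
  (N : nat) :
  eq_mod_Tn N (F_series s C xi) (F_N C xi d N).
Proof.
case: N => [|M] n //; rewrite ltnS => nM.
have [_ [_ b_pos] g_pos _] := C_cone.
have xi1 i : xi (gens C i) != 1.
  by apply: (char_neq1 c_prime c_deg1) => //; case: (g_pos i) => _ [].
(* The coefficient of T^n only sees exponents at most n <= N - 1, which is why
   (N - 1) d is a sufficient total degree. *)
have low (m : 'X_{1..d}) : (forall i : 'I_d, m i <= n)%N -> (mdeg m <= M * d)%N.
  move=> mn; rewrite mdegE (leq_trans (leq_sum _ (fun i _ => mn i))) //.
  by rewrite sum_nat_const card_ord mulnC leq_mul2r nM orbT.
rewrite /F_series (Omega_continuous (fun m mn => G_series_trunc s xi1 (low m mn))).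
rewrite Omega_sum /F_N coefZ coef_sum mulr_sumr; apply: eq_bigr => k _.
rewrite coefZ mulrA; congr (_ * _); apply: Omega_onepT_pow => //.
  by case: s_emb.
by apply: ZEplus_cone_point => // i; case: (g_pos i).
Qed.
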